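(* Every AC06 quantum error-correcting code is a codeword stabilized (CWS) quantum code. That is, for every nonzero Boolean function $f:\{0,1\}^n\to\{0,1\}$ and every $n\times 2n$ binary matrix $A_f$ whose rows are linearly independent over $\mathbb{F}_2$ and have pairwise symplectic inner product zero, the image of the projector $f(P_1,\dots,P_n)$, where $P_i$ is the projector associated with the $i$-th row of $A_f$, is a CWS code.
   Context: Pauli operators and projectors from binary vectors: for $\mathbf{a},\mathbf{b}\in\{0,1\}^n$ let $E_{(\mathbf{a}|\mathbf{b})}=e_1\otimes\cdots\otimes e_n$ with $e_i=I,X,Z,Y$ according to $(a_i,b_i)=(0,0),(1,0),(0,1),(1,1)$ respectively, and let $P_{(\mathbf{a}|\mathbf{b})}=\frac12\bigl(I+E_{(\mathbf{a}|\mathbf{b})}\bigr)$. The symplectic inner product is $(\mathbf{a}|\mathbf{b})\odot(\mathbf{a}'|\mathbf{b}')=\mathbf{a}\cdot\mathbf{b}'\oplus\mathbf{a}'\cdot\mathbf{b}$. Projection logic: for orthogonal projections $P,Q$ on a Hilbert space $H$ with images $K,L$: $P\wedge Q$ is the projection onto $K\cap L$; $P\vee Q$ is the projection onto the smallest subspace containing $K$ and $L$; $\bar P$ is the projection onto $K^\perp$; $P\oplus Q=(P\wedge\bar Q)\vee(\bar P\wedge Q)$. For a Boolean function $f(v_1,\dots,v_n)$, the operator $f(P_1,\dots,P_n)$ is obtained from the Boolean expression of $f$ by replacing $v_i$ by $P_i$, AND by $\wedge$, OR by $\vee$, NOT by $P\mapsto\bar P$ and XOR by $\oplus$. In particular,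 with $\mathcal{C}_f=\{\mathbf{c}\in\{0,1\}^n : f(\mathbf{c})=1\}$, a nonzero $f$ can be written as $f(\mathbf{v})=\sum_{\mathbf{c}\in\mathcal{C}_f}v_1^{c_1}\cdots v_n^{c_n}$ (sum modulo 2, $v_i^1=v_i$, $v_i^0=\bar v_i=v_i\oplus1$). AC06 QECC: the AC06 quantum error-correcting code with data $(f,\{x_i\}_{i=1}^{2n})$, where $x_1,\dots,x_{2n}$ are the columns of an $n\times 2n$ binary matrix $A_f$, is the image of the projector $f(P_1,\dots,P_n)$ on $(\mathbb{C}^2)^{\otimes n}$, where (i) the rows of $A_f$ are linearly independent with pairwise symplectic inner product zero, and (ii) $P_i=P_{(\mathbf{a}_i|\mathbf{b}_i)}$ with $(\mathbf{a}_i|\mathbf{b}_i)$ the $i$-th row of $A_f$. CWS (codeword stabilized) code: let $S$ be an abelian subgroup of the $n$-qubit Pauli group with $|S|=2^n$ and $-I\notin S$, and let $|S\rangle$ be the (unique up to phase) unit vector with $s|S\rangle=|S\rangle$ for all $s\in S$ (a stabilizer state). Let $w_1,\dots,w_K$ be $n$-qubit Pauli operators (word operators) such that $w_1|S\rangle,\dots,w_K|S\rangle$ are mutually orthogonal. The CWS code is the $K$-dimensional span of $w_1|S\rangle,\dots,w_K|S\rangle$. It need not be in standard form. *)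

(* Defs.v *)
From HB Require Import structures.
From mathcomp Require Import all_boot all_order all_algebra.
From mathcomp Require Import spectral sesquilinear.
From mathcomp Require Import finmap.
From mathcomp Require Import complex mxtens.
From mathcomp Require Import reals.

Set Implicit Arguments.
Unset Strict Implicit.
Unset Printing Implicit Defensive.

Import Order.TTheory GRing.Theory Num.Theory.
Local Open Scope ring_scope.
Local Open Scope sesquilinear_scope.

(* <u, v> = \sum_i u_i * (v_i)^*, linear in u and conjugate-linear in v;
   mathcomp's [dotmx] is the same form on row vectors. *)
Definition dotcv (C : numClosedFieldType) (N : nat) (u v : 'cV[C]_N) : C :=
  form_of_matrix Num.conj (1%:M : 'M[C]_1) u v.

Section DotCV.
Variables (C : numClosedFieldType) (N : nat).

HB.instance Definition _ :=
  Bilinear.copy (@dotcv C N) (@form_of_matrix C 1 Num.conj N 1%:M).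
HB.instance Definition _ :=
  Hermitian.copy (@dotcv C N) (@form_of_matrix C 1 Num.conj N 1%:M).

Lemma dotcvE (u v : 'cV[C]_N) : dotcv u v = \sum_i u i 0 * (v i 0)^*.
Proof.
rewrite /dotcv /form_of_matrix mulmx1; apply: eq_bigr => i _.
by rewrite mxE big_ord1 !mxE.
Qed.

Fact dotcv_gt0 (u : 'cV[C]_N) : u != 0 -> 0 < dotcv u u.
Proof.
move=> u0; rewrite dotcvE.
have [i ui0] : exists i, u i 0 != 0.
  apply/existsP; apply: contraNT u0; rewrite negb_exists => /forallP h.
  by apply/eqP/colP => i; rewrite mxE; apply/eqP; rewrite -[_ == _]negbK h.
rewrite (bigD1 i) //= ltr_wpDr ?mul_conjC_gt0 // sumr_ge0 // => j _.
exact: mul_conjC_ge0.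
Qed.

HB.instance Definition _ := isDotProduct.Build _ _ (@dotcv C N) dotcv_gt0.

End DotCV.

Section Projections.
Variables (C : numClosedFieldType) (N : nat).
Local Notation H := ('cV[C]_N).

Definition orthogonal_compl (K : {vspace H}) : {vspace H} :=
  orthov (@dotcv C N) K.

Definition orthogonal_proj (K : {vspace H}) : 'End(H) :=
  daddv_pi K (orthogonal_compl K).

Lemma orthogonal_compl_cap (K : {vspace H}) : (K :&: orthogonal_compl K = 0)%VS.
Proof.
apply/eqP; rewrite -subv0; apply/subvP => x; rewrite memv_cap => /andP[xK].
by move=> /mem_orthovP/(_ x xK) xx0; rewrite memv0 -(dnorm_eq0 (@dotcv C N)) xx0.
Qed.

Lemma orthogonal_compl_add (K : {vspace H}) :
  (K + orthogonal_compl K = fullv)%VS.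
Proof.
apply/eqP; rewrite eqEdim subvf dimv_disjoint_sum ?orthogonal_compl_cap //=.
suff ind (s : seq H) : (\dim {:H} <= size s + \dim (orthogonal_compl <<s>>))%N.
  by have := ind (vbasis K); rewrite size_tuple (span_basis (vbasisP K)).
elim: s => [|u s IHs]; first by rewrite span_nil /orthogonal_compl orthov0.
have := leq_dim_orthov1 (@dotcv C N) u (orthogonal_compl <<s>>).
rewrite span_cons /= => le_dim; rewrite addSnnS (leq_trans IHs) // leq_add2l.
suff /dimvS : (orthogonal_compl <<s>> :&: orthov (@dotcv C N) <[u]>
               <= orthogonal_compl (<[u]> + <<s>>))%VS.
  by move=> /(leq_trans le_dim); rewrite -ltnS; apply/leq_trans/leqSpred.
by rewrite orthovD capvSl capvSr.
Qed.

Lemma orthogonal_projP (K : {vspace H}) (v : H) :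
  orthogonal_proj K v \in K /\
  v - orthogonal_proj K v \in orthogonal_compl K.
Proof.
split; first exact: memv_pi.
have vKL : v \in (K + orthogonal_compl K)%VS.
  by rewrite orthogonal_compl_add memvf.
have {1}<- := daddv_pi_add (orthogonal_compl_cap K) vKL.
by rewrite addrC addrA addNr add0r memv_pi.
Qed.

(* P and Q stand for orthogonal projections; the operations are total on
   'End(H) because they only look at the images. *)
Definition proj_and (P Q : 'End(H)) : 'End(H) :=
  orthogonal_proj (limg P :&: limg Q).
Definition proj_or (P Q : 'End(H)) : 'End(H) :=
  orthogonal_proj (limg P + limg Q).
Definition proj_not (P : 'End(H)) : 'End(H) :=
  orthogonal_proj (orthogonal_compl (limg P)).
Definition proj_xor (P Q : 'End(H)) : 'End(H) :=
  proj_or (proj_and P (proj_not Q)) (proj_and (proj_not P) Q).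

End Projections.

Inductive bexpr (n : nat) : Type :=
  | BVar of 'I_n
  | BConst of bool
  | BAnd of bexpr n & bexpr n
  | BOr of bexpr n & bexpr n
  | BNot of bexpr n
  | BXor of bexpr n & bexpr n.

Arguments BConst {n}.

Fixpoint beval (n : nat) (v : 'I_n -> bool) (e : bexpr n) : bool :=
  match e with
  | BVar i => v i
  | BConst b => b
  | BAnd e1 e2 => beval v e1 && beval v e2
  | BOr e1 e2 => beval v e1 || beval v e2
  | BNot e1 => ~~ beval v e1
  | BXor e1 e2 => beval v e1 (+) beval v e2
  end.

Fixpoint proj_eval (C : numClosedFieldType) (N n : nat)
    (P : 'I_n -> 'End('cV[C]_N)) (e : bexpr n) : 'End('cV[C]_N) :=
  match e with
  | BVar i => P i
  | BConst b => if b then \1%VF else 0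
  | BAnd e1 e2 => proj_and (proj_eval P e1) (proj_eval P e2)
  | BOr e1 e2 => proj_or (proj_eval P e1) (proj_eval P e2)
  | BNot e1 => proj_not (proj_eval P e1)
  | BXor e1 e2 => proj_xor (proj_eval P e1) (proj_eval P e2)
  end.

Definition expresses (n : nat) (e : bexpr n)
    (f : {ffun 'I_n -> bool} -> bool) : Prop :=
  forall v : {ffun 'I_n -> bool}, beval v e = f v.

(* [minterm_sum f] is the expression
   \sum_(c | f c = 1) v_1^(c_1) ... v_n^(c_n), with v^1 = v, v^0 = ~ v and the
   sum taken modulo 2. *)
Definition minterm (n : nat) (c : {ffun 'I_n -> bool}) : bexpr n :=
  foldr (fun i => BAnd (if c i then BVar i else BNot (BVar i)))
        (BConst true) (enum 'I_n).

Definition minterm_sum (n : nat) (f : {ffun 'I_n -> bool} -> bool) : bexpr n :=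
  foldr (fun c => BXor (minterm c)) (BConst false)
        (enum [pred c | f c]).

Lemma beval_minterm (n : nat) (v c : {ffun 'I_n -> bool}) :
  beval v (minterm c) = (v == c).
Proof.
have -> : beval v (minterm c) = all (fun i => v i == c i) (enum 'I_n).
  rewrite /minterm; elim: (enum 'I_n) => //= i s ->.
  by case: (c i) => /=; case: (v i).
apply/allP/eqP => [vc | -> //]; apply/ffunP => i.
by apply/eqP/vc; rewrite mem_enum.
Qed.

Lemma minterm_sumP (n : nat) (f : {ffun 'I_n -> bool} -> bool) :
  expresses (minterm_sum f) f.
Proof.
move=> v; have -> : f v = (v \in enum [pred c | f c]) by rewrite mem_enum.
rewrite /minterm_sum; have := enum_uniq [pred c | f c].
elim: (enum _) => //= c s IHs /andP[cNs /IHs ->]; rewrite beval_minterm inE.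
by case: eqP cNs => // -> /negbTE ->.
Qed.

Fixpoint qdim (n : nat) : nat := if n is m.+1 then (2 * qdim m)%N else 1%N.

Lemma qdimE (n : nat) : qdim n = (2 ^ n)%N.
Proof. by elim: n => //= n ->; rewrite expnS. Qed.

Section Pauli.
Variable C : numClosedFieldType.

Fixpoint tensor (n : nat) : ('I_n -> 'M[C]_2) -> 'M[C]_(qdim n) :=
  match n with
  | 0 => fun _ => 1%:M
  | m.+1 => fun e => e ord0 *t tensor (fun i => e (lift ord0 i))
  end.

Definition mx2 (a b c d : C) : 'M[C]_2 :=
  block_mx a%:M b%:M c%:M (d%:M : 'M_1).

Definition pauliI : 'M[C]_2 := 1%:M.
Definition pauliX : 'M[C]_2 := mx2 0 1 1 0.
Definition pauliY : 'M[C]_2 := mx2 0 (- 'i) 'i 0.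
Definition pauliZ : 'M[C]_2 := mx2 1 0 0 (- 1).

Definition pauli1 (a b : 'F_2) : 'M[C]_2 :=
  if a == 0 then (if b == 0 then pauliI else pauliZ)
  else (if b == 0 then pauliX else pauliY).

(* A binary vector (a|b) of length 2n is a row vector of length n + n, with
   a and b its left and right halves. *)
Definition pauli (n : nat) (u : 'rV['F_2]_(n + n)) : 'M[C]_(qdim n) :=
  tensor (fun i => pauli1 (lsubmx u 0 i) (rsubmx u 0 i)).

Definition pauli_projector (n : nat) (u : 'rV['F_2]_(n + n)) :
    'M[C]_(qdim n) :=
  2^-1 *: (1%:M + pauli u).

Definition in_pauli_group (n : nat) (M : 'M[C]_(qdim n)) : Prop :=
  exists (k : nat) (u : 'rV['F_2]_(n + n)), M = 'i ^+ k *: pauli u.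

End Pauli.

Definition symplectic (n : nat) (u v : 'rV['F_2]_(n + n)) : 'F_2 :=
  \sum_i lsubmx u 0 i * rsubmx v 0 i + \sum_i lsubmx v 0 i * rsubmx u 0 i.

Section Codes.
Variables (C : numClosedFieldType) (n : nat).
Local Notation H := ('cV[C]_(qdim n)).

(* The image of f(P_1, ..., P_n), for the expression e of f. *)
Definition AC06_code (e : bexpr n) (A : 'M['F_2]_(n, n + n)) : {vspace H} :=
  limg (proj_eval
    (fun i => linfun (mulmx (pauli_projector C (row i A))) : 'End(H)) e).

Definition stabilizer_group (S : {fset 'M[C]_(qdim n)}) : Prop :=
  [/\ {in S, forall s, in_pauli_group s},
      [/\ 1%:M \in S, {in S &, forall s t, s *m t \in S}
        & {in S, forall s, invmx s \in S}],
      {in S &, forall s t, s *m t = t *m s},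
      #|` S| = (2 ^ n)%N
    & (- 1)%:M \notin S].

Definition stabilizer_state (S : {fset 'M[C]_(qdim n)}) (psi : H) : Prop :=
  dotcv psi psi = 1 /\ {in S, forall s, s *m psi = psi}.

Definition CWS_code (Q : {vspace H}) : Prop :=
  exists (S : {fset 'M[C]_(qdim n)}) (psi : H)
         (K : nat) (w : 'I_K -> 'M[C]_(qdim n)),
    [/\ stabilizer_group S /\ stabilizer_state S psi,
        (0 < K)%N,
        forall k, in_pauli_group (w k),
        forall j k, j != k -> dotcv (w j *m psi) (w k *m psi) = 0
      & Q = <<[seq w k *m psi | k : 'I_K]>>%VS].

End Codes.

(* Main.v *)
(** Let E_i be the Pauli operator of row i of A. The E_i are commuting Hermitian
    involutions, so they have a joint eigenvector. As the rows are independent,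
    every sign pattern d in F_2^n is the symplectic product of some u_d with
    the rows, and the Pauli operator of u_d flips the eigenvalues of a joint
    eigenvector according to d. Hence there is a unit vector psi fixed by all
    E_i, and the 2^n vectors b_d = (Pauli of u_d) psi, with
    E_i b_d = (-1)^(d_i) b_d, form an orthogonal basis. All projections built
    from the P_i are diagonal in this basis, where the operations of projection
    logic become the Boolean ones: the image of f(P_1, ..., P_n) is spanned by
    the b_d such that f holds at (d_i = 0)_i. The stabilizer of psi consists of
    the operators +/- (Pauli of x A), with the sign that fixes psi: they act on
    b_d as (-1)^(x . d), and the group axioms are checked on the basis. *)

Require Import Defs.
From mathcomp Require Import all_boot all_order all_algebra.
From mathcomp Require Import complex reals.
From mathcomp Require Import sesquilinear finmap mxtens.
From mathcomp Require Import ring.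

Set Implicit Arguments.
Unset Strict Implicit.
Unset Printing Implicit Defensive.

Import Order.TTheory GRing.Theory Num.Theory.
Local Open Scope ring_scope.

Lemma F2P (x : 'F_2) : x = 0 \/ x = 1.
Proof.
by case: x => -[|[|//]] ?; [left | right]; apply: val_inj.
Qed.

(** * The sign character of ['F_2] *)

Section SignF2.
Variable C : numClosedFieldType.

Definition signF2 (x : 'F_2) : C := (-1) ^+ x.

Lemma signF2_0 : signF2 0 = 1. Proof. by []. Qed.

Lemma signF2_1 : signF2 1 = -1. Proof. by []. Qed.

Lemma signF2D : {morph signF2 : x y / x + y >-> x * y}.
Proof.
by move=> x y; rewrite /signF2; case: (F2P x) => ->; case: (F2P y) => ->;
  rewrite ?addr0 ?add0r ?mulr1 ?mul1r //= mulrNN mulr1.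
Qed.

Lemma signF2_sum I (r : seq I) (P : pred I) (F : I -> 'F_2) :
  \prod_(i <- r | P i) signF2 (F i) = signF2 (\sum_(i <- r | P i) F i).
Proof. by rewrite (big_morph _ signF2D signF2_0). Qed.

Lemma signF2_inj : injective signF2.
Proof.
have N11 : (1 : C) <> -1.
  by move/eqP; rewrite eq_sym -subr_eq0 -opprD oppr_eq0 -mulr2n pnatr_eq0.
move=> x y; case: (F2P x) => ->; case: (F2P y) => ->; rewrite ?signF2_0 ?signF2_1 //.
by move=> H; case: N11.
Qed.

Lemma signF2_sqr x : signF2 x * signF2 x = 1.
Proof. by rewrite -expr2 sqrr_sign. Qed.

Lemma conj_signF2 x : (signF2 x)^* = signF2 x.
Proof. by rewrite rmorphXn rmorphN1. Qed.

End SignF2.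

(** * The symplectic form as a matrix product *)

Section Symplectic.
Variable n : nat.
Implicit Types u v : 'rV['F_2]_(n + n).

Lemma symplecticE u v :
  symplectic u v = (v *m (row_mx (rsubmx u) (lsubmx u))^T) 0 0.
Proof.
rewrite -[in RHS](hsubmxK v) tr_row_mx mul_row_col !mxE addrC.
by congr (_ + _); apply: eq_bigr => i _; rewrite !mxE // mulrC.
Qed.

Lemma symplecticC u v : symplectic u v = symplectic v u.
Proof. by rewrite /symplectic addrC. Qed.

Lemma symplectic_mulmx m (A : 'M['F_2]_(m, n + n)) (x : 'rV_m) u :
  symplectic u (x *m A) = \sum_i x 0 i * symplectic u (row i A).
Proof.
rewrite symplecticE -mulmxA mxE; apply: eq_bigr => i _.
by rewrite symplecticE -row_mul [in RHS]mxE.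
Qed.

(** A right inverse [B] of [A] solves [A *m v^T = d^T]; exchanging the two halves of [v] turns this
    matrix product into the symplectic one. *)
Lemma symplectic_surj m (A : 'M['F_2]_(m, n + n)) (d : 'rV_m) :
  row_free A -> exists u, forall i, symplectic u (row i A) = d 0 i.
Proof.
case/row_freeP => B AB; set v := (B *m d^T)^T.
exists (row_mx (rsubmx v) (lsubmx v)) => i.
rewrite symplecticE row_mxKl row_mxKr hsubmxK trmxK -row_mul mulmxA AB mul1mx.
by rewrite !mxE.
Qed.

End Symplectic.

(** * Commutation, squares and adjoints of Pauli operators *)

Section PauliAlgebra.
Variable C : numClosedFieldType.
Local Notation "M ^*t" := (map_mx Num.conj M^T) (at level 2).

Lemma tens1mx1 m p : (1%:M : 'M[C]_m) *t (1%:M : 'M[C]_p) = 1%:M.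
Proof.
apply/matrixP => i j; case: (mxtens_indexP i) => i0 i1.
case: (mxtens_indexP j) => j0 j1; rewrite tensmxE !mxE -natrM mulnb.
by rewrite (inj_eq (can_inj (@mxtens_indexK m p))) xpair_eqE.
Qed.

Lemma tens_scalel m1 n1 m2 n2 (a : C) (A : 'M_(m1, n1)) (B : 'M_(m2, n2)) :
  (a *: A) *t B = a *: (A *t B).
Proof. by apply/matrixP => i j; rewrite !mxE mulrA. Qed.

Lemma tens_scaler m1 n1 m2 n2 (a : C) (A : 'M_(m1, n1)) (B : 'M_(m2, n2)) :
  A *t (a *: B) = a *: (A *t B).
Proof. by apply/matrixP => i j; rewrite !mxE mulrCA. Qed.

Lemma eq_tensor n (e f : 'I_n -> 'M[C]_2) : e =1 f -> tensor e = tensor f.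
Proof.
elim: n e f => //= n IHn e f ef; rewrite ef.
by congr (_ *t _); apply: IHn => i; apply: ef.
Qed.

Lemma tensor1 n : tensor (fun _ : 'I_n => 1%:M : 'M[C]_2) = 1%:M.
Proof. by elim: n => //= n ->; rewrite tens1mx1. Qed.

Lemma tensorM n (e f : 'I_n -> 'M[C]_2) :
  tensor e *m tensor f = tensor (fun i => e i *m f i).
Proof.
by elim: n e f => [|n IHn] e f /=; rewrite ?mulmx1 // tensmx_mul IHn.
Qed.

Lemma tensorZ n (a : 'I_n -> C) (e : 'I_n -> 'M[C]_2) :
  tensor (fun i => a i *: e i) = \prod_i a i *: tensor e.
Proof.
elim: n a e => [|n IHn] a e /=; first by rewrite big_ord0 scale1r.
by rewrite IHn tens_scalel tens_scaler scalerA big_ord_recl.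
Qed.

Lemma tensor_adj n (e : 'I_n -> 'M[C]_2) :
  (tensor e)^*t = tensor (fun i => (e i)^*t).
Proof.
elim: n e => [|n IHn] e /=; first by rewrite trmx1 map_mx1.
by rewrite trmx_tens map_mxT IHn.
Qed.

Lemma mx2M (a b c d a' b' c' d' : C) :
  mx2 a b c d *m mx2 a' b' c' d' =
  mx2 (a * a' + b * c') (a * b' + b * d') (c * a' + d * c') (c * b' + d * d').
Proof. by rewrite /mx2 (@mulmx_block _ 1 1 1 1 1 1) -!scalar_mxM -!raddfD. Qed.

Lemma mx2Z (k a b c d : C) :
  k *: mx2 a b c d = mx2 (k * a) (k * b) (k * c) (k * d).
Proof. by rewrite /mx2 (@scale_block_mx _ 1 1 1 1) !scale_scalar_mx. Qed.

Lemma mx2_adj (a b c d : C) : (mx2 a b c d)^*t = mx2 a^* c^* b^* d^*.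
Proof.
rewrite /mx2 (@tr_block_mx _ 1 1 1 1) (@map_block_mx _ _ _ 1 1 1 1).
by rewrite !tr_scalar_mx !map_scalar_mx.
Qed.

Lemma mx2_1 : mx2 1 0 0 1 = 1%:M :> 'M[C]_2.
Proof. by rewrite /mx2 (@scalar_mx_block _ 1 1) !raddf0. Qed.

(** Puts the identity in [mx2] form too, so that the case analyses below compute all products by the
    same entry rule. *)
Lemma pauli1E (a b : 'F_2) : pauli1 C a b =
  if a == 0 then (if b == 0 then mx2 1 0 0 1 else mx2 1 0 0 (-1))
  else (if b == 0 then mx2 0 1 1 0 else mx2 0 (- 'i) 'i 0).
Proof. by rewrite mx2_1. Qed.

Lemma pauli1_mulC (a b a' b' : 'F_2) : pauli1 C a b *m pauli1 C a' b' =
  signF2 C (a * b' + a' * b) *: (pauli1 C a' b' *m pauli1 C a b).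
Proof.
by rewrite !pauli1E; case: (F2P a) => ->; case: (F2P b) => ->;
  case: (F2P a') => ->; case: (F2P b') => ->;
  rewrite !mx2M mx2Z /signF2 ?(mulr0, mul0r, mul1r, mulr1, addr0, add0r) /=;
  congr mx2; rewrite ?(expr1, expr0); ring.
Qed.

Lemma pauli1_sqr (a b : 'F_2) : pauli1 C a b *m pauli1 C a b = 1%:M.
Proof.
have ii : 'i * 'i = -1 :> C by rewrite -expr2 sqrCi.
by rewrite !pauli1E -mx2_1; case: (F2P a) => ->; case: (F2P b) => ->;
  rewrite mx2M /=; congr mx2;
  rewrite ?(mulNr, mulrN, ii, mulr0, mul0r, mulr1, addr0, add0r, oppr0, opprK).
Qed.

Lemma pauli1_adj (a b : 'F_2) : (pauli1 C a b)^*t = pauli1 C a b.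
Proof.
by rewrite !pauli1E; case: (F2P a) => ->; case: (F2P b) => ->;
  rewrite mx2_adj /= ?rmorphN /= ?(conjC0, conjC1, conjCi, opprK).
Qed.

Variable n : nat.
Implicit Types u v : 'rV['F_2]_(n + n).

(** The one-qubit signs multiply over the tensor factors, so their exponents add up to the
    symplectic product. *)
Lemma pauli_mulC u v : pauli C u *m pauli C v =
  signF2 C (symplectic u v) *: (pauli C v *m pauli C u).
Proof.
rewrite !tensorM /symplectic -big_split -signF2_sum -tensorZ.
exact/eq_tensor/(fun i => pauli1_mulC _ _ _ _).
Qed.

Lemma pauli_sqr u : pauli C u *m pauli C u = 1%:M.
Proof.
by rewrite tensorM -(tensor1 n); apply: eq_tensor => i; rewrite pauli1_sqr.
Qed.

Lemma pauli_adj u : (pauli C u)^*t = pauli C u.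
Proof. by rewrite tensor_adj; apply: eq_tensor => i; rewrite pauli1_adj. Qed.

Lemma dotcv_pauli u (x y : 'cV[C]_(qdim n)) :
  dotcv (pauli C u *m x) y = dotcv x (pauli C u *m y).
Proof.
rewrite /dotcv /form_of_matrix !mulmx1 trmx_mul map_mxM pauli_adj.
by rewrite -mulmxA mxtrace_mulC mulmxA.
Qed.

Lemma mulmx_pauli_eq0 u (x : 'cV[C]_(qdim n)) :
  (pauli C u *m x == 0) = (x == 0).
Proof.
apply/eqP/eqP => [ux0|->]; last by rewrite mulmx0.
by rewrite -[x]mul1mx -(pauli_sqr u) -mulmxA ux0 mulmx0.
Qed.

End PauliAlgebra.

(** * Projection logic on subspaces spanned by parts of an orthogonal basis *)

Section OrthogonalBasis.
Variables (C : numClosedFieldType) (N : nat) (I : finType) (b : I -> 'cV[C]_N).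
Hypothesis b_neq0 : forall i, b i != 0.
Hypothesis b_orth : forall i j, i != j -> dotcv (b i) (b j) = 0.
Hypothesis card_b : #|I| = N.

Definition bspan (T : pred I) : {vspace 'cV[C]_N} := <<[seq b i | i in T]>>.

Lemma mem_bspan (T : pred I) i : T i -> b i \in bspan T.
Proof. by move=> Ti; apply/memv_span/imageP; exists i. Qed.

Lemma eq_bspan (T U : pred I) : T =1 U -> bspan T = bspan U.
Proof. by move=> TU; rewrite /bspan (eq_image TU (frefl _)). Qed.

(** Nonzero orthogonal vectors are free, and there are [N] of them, so they span; pairing with [b i]
    then isolates the coefficient of [b i]. *)
Lemma bspan_expand v : v = \sum_i (dotcv v (b i) / dotcv (b i) (b i)) *: b i.
Proof.
have dot_sum (k : I -> C) j :
    dotcv (\sum_i k i *: b i) (b j) = k j * dotcv (b j) (b j).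
  rewrite linear_sumlz (bigD1 j) //= linearZl_LR big1 ?addr0 // => i ij.
  by rewrite linearZl_LR /= b_orth // mulr0.
have freeb : free (codom_tuple b).
  apply/freeP => k; under eq_bigr do rewrite nth_codom.
  rewrite (reindex_onto enum_rank enum_val) /= => [|i _]; last exact: enum_valK.
  under eq_bigl do rewrite enum_rankK eqxx.
  under eq_bigr do rewrite enum_rankK.
  move=> sum0 i; have := dot_sum (k \o enum_rank) (enum_val i).
  rewrite /= sum0 linear0l enum_valK => /esym/eqP.
  by rewrite mulf_eq0 dnorm_eq0 (negPf (b_neq0 _)) orbF => /eqP.
have spanb : <<codom_tuple b>>%VS = fullv.
  apply/eqP; rewrite eqEdim subvf (eqP freeb) size_tuple card_b.
  by rewrite dimvf /dim /= muln1.
have /coord_span : v \in <<codom_tuple b>>%VS by rewrite spanb memvf.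
under eq_bigr do rewrite nth_codom.
rewrite (reindex_onto enum_rank enum_val) /= => [|i _]; last exact: enum_valK.
under eq_bigl do rewrite enum_rankK eqxx.
under eq_bigr do rewrite enum_rankK.
move=> def_v; rewrite {1}def_v; apply: eq_bigr => i _.
rewrite {2}def_v (dot_sum (fun i => coord (codom_tuple b) (enum_rank i) v)).
by rewrite mulfK // dnorm_eq0.
Qed.

(** Membership becomes a condition on each index separately, which is what turns intersection and
    orthogonal complement into Boolean operations on index sets. *)
Lemma bspanP (T : pred I) v :
  reflect (forall i, ~~ T i -> dotcv v (b i) = 0) (v \in bspan T).
Proof.
apply: (iffP idP) => [vT i Ti|v0].
  have /orthovP : (bspan T <= orthov (@dotcv C N) <[b i]>)%VS.
    apply/span_subvP => _ /imageP[j Tj ->]; rewrite mem_orthov1 /= b_orth //.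
    by apply: contraNneq Ti => <-.
  by apply=> //; apply: memv_line.
rewrite [v]bspan_expand memv_suml // => i _.
have [Ti|/v0->] := boolP (T i); first by rewrite memvZ ?mem_bspan.
by rewrite mul0r scale0r mem0v.
Qed.

Lemma bspan0 : bspan pred0 = 0%VS.
Proof. by rewrite /bspan /image_mem enum0 span_nil. Qed.

Lemma bspanT : bspan predT = fullv.
Proof.
by apply/eqP; rewrite eqEsubv subvf; apply/subvP => v _; apply/bspanP.
Qed.

Lemma bspanI (T U : pred I) :
  (bspan T :&: bspan U)%VS = bspan (predI T U).
Proof.
apply/vspaceP => v; rewrite memv_cap; apply/andP/bspanP => [[vT vU] i|v0].
  by rewrite negb_and => /orP[] Ni;
    [have /bspanP := vT | have /bspanP := vU]; apply.
by split; apply/bspanP => i Ni; apply: v0; rewrite /= negb_and Ni ?orbT.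
Qed.

Lemma bspanU (T U : pred I) :
  (bspan T + bspan U)%VS = bspan (predU T U).
Proof.
apply/eqP; rewrite eqEsubv subv_add -!andbA; apply/and3P; split.
- by apply/span_subvP => _ /imageP[i Ti ->]; rewrite mem_bspan //= [T i]Ti.
- by apply/span_subvP => _ /imageP[i Ui ->]; rewrite mem_bspan //= [U i]Ui orbT.
apply/span_subvP => _ /imageP[i /orP[]Pi ->].
  by apply: (subvP (addvSl _ _)); apply: mem_bspan.
by apply: (subvP (addvSr _ _)); apply: mem_bspan.
Qed.

Lemma bspanC (T : pred I) :
  orthogonal_compl (bspan T) = bspan (predC T).
Proof.
apply/vspaceP => v; apply/mem_orthovP/bspanP => [vT i|v0 u uT].
  by rewrite negbK => Ti; apply/vT/mem_bspan.
have /orthovP : (bspan T <= orthov (@dotcv C N) <[v]>)%VS.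
  apply/span_subvP => _ /imageP[i Ti ->].
  by rewrite mem_orthov1 herm_eq0C; apply/eqP/v0; rewrite negbK.
move=> /(_ u v uT (memv_line v))/eqP; rewrite herm_eq0C.
by move/eqP.
Qed.

Lemma limg_bspan (g : 'End('cV[C]_N)) (T : pred I) :
  (forall i, g (b i) = (T i)%:R *: b i) -> limg g = bspan T.
Proof.
move=> gb; apply/eqP; rewrite eqEsubv; apply/andP; split; last first.
  apply/span_subvP => _ /imageP[i Ti ->].
  by rewrite -[b i]scale1r -[1]/(true%:R) -[true]Ti -gb memv_img ?memvf.
rewrite -bspanT limg_span; apply/span_subvP => _ /mapP[_ /imageP[i _ ->] ->].
rewrite gb; case Ti: (T i); last by rewrite scale0r mem0v.
by rewrite scale1r mem_bspan.
Qed.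

Lemma limg_orthogonal_proj (K : {vspace 'cV[C]_N}) : limg (orthogonal_proj K) = K.
Proof.
apply/eqP; rewrite eqEsubv; apply/andP; split.
  by apply/subvP => _ /memv_imgP[v _ ->]; case: (orthogonal_projP K v).
apply/subvP => v vK; rewrite -(daddv_pi_id (orthogonal_compl_cap K) vK).
by rewrite memv_img ?memvf.
Qed.

(** Here [c i k] is the truth value of variable [k] at the basis vector [b i]. By induction on [e],
    each image is spanned by basis vectors, and there the subspace lattice is Boolean. *)
Lemma limg_proj_eval m (P : 'I_m -> 'End('cV[C]_N)) (c : I -> 'I_m -> bool)
    (e : bexpr m) :
  (forall k, limg (P k) = bspan (fun i => c i k)) ->
  limg (proj_eval P e) = bspan (fun i => beval (c i) e).
Proof.
move=> Pc; elim: e => //= [[] | e1 IH1 e2 IH2 | e1 IH1 e2 IH2 | e1 IH1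
                          | e1 IH1 e2 IH2].
- by rewrite lim1g bspanT.
- by rewrite lim0g bspan0.
- by rewrite limg_orthogonal_proj IH1 IH2 bspanI.
- by rewrite limg_orthogonal_proj IH1 IH2 bspanU.
- by rewrite limg_orthogonal_proj IH1 bspanC.
rewrite !limg_orthogonal_proj IH1 IH2 !bspanC.
rewrite !bspanI bspanU; apply: eq_bspan => i /=.
by case: beval; case: beval.
Qed.

Lemma eq_mx_basis (M M' : 'M[C]_N) :
  (forall i, M *m b i = M' *m b i) -> M = M'.
Proof.
move=> MM'; suff MM'v (v : 'cV_N) : M *m v = M' *m v.
  apply/matrixP => i j; have := MM'v (delta_mx j 0).
  by rewrite -!colE => /colP/(_ i); rewrite !mxE.
rewrite [v]bspan_expand !mulmx_sumr; apply: eq_bigr => i _.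
by rewrite -!scalemxAr MM'.
Qed.

End OrthogonalBasis.

Local Open Scope complex_scope.

Lemma eq_beval n (v w : 'I_n -> bool) (e : bexpr n) :
  v =1 w -> beval v e = beval w e.
Proof.
by move=> vw; elim: e => //= [e1 -> e2 ->|e1 -> e2 ->|e1 ->|e1 -> e2 ->].
Qed.

(** * How Pauli operators act on each other's eigenvectors *)

Section PauliEigenvectors.
Variables (C : numClosedFieldType) (n : nat).
Implicit Types (u : 'rV['F_2]_(n + n)) (v w : 'cV[C]_(qdim n)).

Lemma pauli_eigen_shift u u' v (x : 'F_2) :
  pauli C u' *m v = signF2 C x *: v ->
  pauli C u' *m (pauli C u *m v) =
    signF2 C (symplectic u u' + x) *: (pauli C u *m v).
Proof.
move=> Ev; rewrite mulmxA pauli_mulC -scalemxAl -mulmxA Ev -scalemxAr.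
by rewrite scalerA -signF2D symplecticC.
Qed.

(** Pauli operators are self-adjoint and the signs are real, so distinct signs force
    orthogonality. *)
Lemma pauli_eigen_orth u v w (x y : 'F_2) :
  pauli C u *m v = signF2 C x *: v -> pauli C u *m w = signF2 C y *: w ->
  x != y -> dotcv v w = 0.
Proof.
move=> Ev Ew; rewrite -(inj_eq (@signF2_inj C)) => xy.
apply/eqP; have := dotcv_pauli u v w; rewrite Ev Ew linearZl_LR linearZr_LR /=.
move/eqP; rewrite conj_signF2 -subr_eq0 -mulrBl mulf_eq0 subr_eq0.
by rewrite (negPf xy).
Qed.

Lemma unit_vector_scale v : v != 0 ->
  dotcv ((sqrtC (dotcv v v))^-1 *: v) ((sqrtC (dotcv v v))^-1 *: v) = 1.
Proof.
move=> v0; have q0 := dotcv_gt0 v0; set q := dotcv v v in q0 *.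
have r0 : 0 < (sqrtC q)^-1 by rewrite invr_gt0 sqrtC_gt0.
rewrite linearZl_LR linearZr_LR /= (CrealP (gtr0_real r0)) mulrA -expr2 exprVn.
by rewrite sqrtCK mulVf // gt_eqF.
Qed.

End PauliEigenvectors.

(** * Joint eigenvectors of the rows of [A] *)

Section StabilizerBasis.
Variables (C : numClosedFieldType) (n : nat) (A : 'M['F_2]_(n, n + n)).
Hypothesis A_free : row_free A.
Hypothesis A_isotropic : forall i j : 'I_n, symplectic (row i A) (row j A) = 0.
Local Notation H := 'cV[C]_(qdim n).
Local Notation E i := (pauli C (row i A)).

Lemma exists_joint_eigenvector :
  exists2 v : H, v != 0 &
    exists d : 'rV['F_2]_n, forall i, E i *m v = signF2 C (d 0 i) *: v.
Proof.
(* Restricting to the rows in a list allows an induction that makes [v] an eigenvector of one more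
   row at a time. *)
suff [v v0 Ev] : exists2 v : H, v != 0 &
    forall i, i \in enum 'I_n -> exists x, E i *m v = signF2 C x *: v.
  have [d dP] := fin_all_exists (fun i => Ev i (mem_enum _ i)).
  exists v => //.
  by exists (\row_i d i) => i; rewrite mxE.
elim: (enum 'I_n) => [|i s [v v0 Ev]].
  exists (const_mx 1) => //; apply/negP => /eqP/matrixP.
  have q0 : (0 < qdim n)%N by rewrite qdimE expn_gt0.
  by move=> /(_ (Ordinal q0) 0)/eqP; rewrite !mxE oner_eq0.
(* As E_i^2 = 1, v + E_i v is fixed by E_i, unless it vanishes, and then
   E_i v = - v. *)
have [sum0|sum_neq0] := eqVneq (v + E i *m v) 0.
  exists v => // j; rewrite inE => /predU1P[->|/Ev//].
  by exists 1; rewrite scaleN1r; apply/eqP; rewrite -addr_eq0 addrC sum0.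
exists (v + E i *m v) => // j; rewrite inE => /predU1P[->|/Ev[x Ejv]].
  by exists 0; rewrite mulmxDr mulmxA pauli_sqr mul1mx scale1r addrC.
(* By isotropy [E j] commutes with [E i], so the earlier eigenvalues survive the passage to
   [v + E i *m v]. *)
exists x; rewrite mulmxDr (pauli_eigen_shift _ Ejv) A_isotropic add0r.
by rewrite Ejv scalerDr.
Qed.

Lemma exists_stabilized_vector :
  exists2 psi : H, dotcv psi psi = 1 & forall i, E i *m psi = psi.
Proof.
have [v v0 [d Ev]] := exists_joint_eigenvector.
(* Applying the Pauli operator of [u] changes the signs from [d] to [d + d = 0]. *)
have [u ud] := symplectic_surj d A_free.
have uv0 : pauli C u *m v != 0 by rewrite mulmx_pauli_eq0.
exists ((sqrtC (dotcv (pauli C u *m v) (pauli C u *m v)))^-1 *: (pauli C u *m v)).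
  exact: unit_vector_scale.
move=> i; rewrite -scalemxAr (pauli_eigen_shift u (Ev i)) ud.
by case: (F2P (d 0 i)) => ->; rewrite scale1r.
Qed.

(** * The eigenbasis indexed by syndromes *)

Variables (psi : H) (u : 'rV['F_2]_n -> 'rV['F_2]_(n + n)).
Hypothesis psi_unit : dotcv psi psi = 1.
Hypothesis E_psi : forall i, E i *m psi = psi.
Hypothesis u_row : forall d i, symplectic (u d) (row i A) = d 0 i.

(** In coding terms, [u d] is an error with syndrome [d], applied to the stabilizer state. *)
Definition syndrome_basis d : H := pauli C (u d) *m psi.
Local Notation b := syndrome_basis.

Lemma psi_neq0 : psi != 0.
Proof.
by apply/eqP => psi0; move/eqP: psi_unit; rewrite psi0 linear0l eq_sym oner_eq0.
Qed.

Lemma syndrome_basis_eigen d i : E i *m b d = signF2 C (d 0 i) *: b d.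
Proof.
have Epsi : E i *m psi = signF2 C 0 *: psi by rewrite scale1r E_psi.
by rewrite (pauli_eigen_shift (u d) Epsi) u_row addr0.
Qed.

Lemma syndrome_basis_neq0 d : b d != 0.
Proof. by rewrite mulmx_pauli_eq0 psi_neq0. Qed.

Lemma joint_eigen_orth (v w : H) (d d' : 'rV['F_2]_n) :
  (forall i, E i *m v = signF2 C (d 0 i) *: v) ->
  (forall i, E i *m w = signF2 C (d' 0 i) *: w) ->
  d != d' -> dotcv v w = 0.
Proof.
move=> Ev Ew; rewrite -subr_eq0 => /rV0Pn[k].
by rewrite !mxE subr_eq0; apply: pauli_eigen_orth.
Qed.

Lemma syndrome_basis_orth d d' : d != d' -> dotcv (b d) (b d') = 0.
Proof. exact/joint_eigen_orth/syndrome_basis_eigen/syndrome_basis_eigen. Qed.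

Lemma card_syndromes : #|'rV['F_2]_n| = qdim n.
Proof. by rewrite card_mx card_Fp // mul1n qdimE. Qed.

Local Notation expand :=
  (bspan_expand syndrome_basis_neq0 syndrome_basis_orth card_syndromes).

(* A vector fixed by all E_i is orthogonal to b d for d != 0. *)
Lemma stabilized_collinear (v : H) :
  (forall i, E i *m v = v) -> exists a, v = a *: psi.
Proof.
have line (w : H) : (forall i, E i *m w = w) -> exists a, w = a *: b 0.
  move=> Ew; exists (dotcv w (b 0) / dotcv (b 0) (b 0)).
  rewrite {1}[w]expand (bigD1 0) //= big1 ?addr0 // => d d0.
  rewrite (@joint_eigen_orth w (b d) 0 d) ?mul0r ?scale0r 1?eq_sym //.
    by move=> i; rewrite mxE scale1r Ew.
  exact: syndrome_basis_eigen.
(* [u 0] may be nonzero, so [b 0] need not equal [psi]; [line] applied to [psi] itself gives the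
   factor [c] between them. *)
move=> /line[a ->]; have [c psiE] := line _ E_psi; exists (a / c).
have c0 : c != 0.
  by apply: contraNneq psi_neq0 => c0; rewrite psiE c0 scale0r.
by rewrite psiE scalerA divfK.
Qed.

(** By isotropy the operator commutes with every [E i], so the image of [psi] is again fixed by them
    and is a multiple of [psi]; the operator squares to 1, so the factor is a sign. *)
Lemma pauli_span_psi (x : 'rV['F_2]_n) :
  exists s, pauli C (x *m A) *m psi = signF2 C s *: psi.
Proof.
have [i|a xpsi] := @stabilized_collinear (pauli C (x *m A) *m psi).
  have Epsi : E i *m psi = signF2 C 0 *: psi by rewrite scale1r E_psi.
  rewrite (pauli_eigen_shift _ Epsi) symplecticC symplectic_mulmx addr0.
  by rewrite big1 ?scale1r // => j _; rewrite A_isotropic mulr0.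
have : a ^+ 2 *: psi == 1 *: psi.
  by rewrite expr2 -scalerA -xpsi scalemxAr -xpsi mulmxA pauli_sqr mul1mx scale1r.
rewrite -subr_eq0 -scalerBl scaler_eq0 (negPf psi_neq0) orbF subr_eq0 sqrf_eq1.
by case/orP => /eqP aE; [exists 0 | exists 1]; rewrite xpsi aE.
Qed.

(** * The stabilizer group of [psi] *)

Variable eps : 'rV['F_2]_n -> 'F_2.
Hypothesis eps_psi :
  forall x, pauli C (x *m A) *m psi = signF2 C (eps x) *: psi.

Definition stabilizer x : 'M[C]_(qdim n) := signF2 C (eps x) *: pauli C (x *m A).
Local Notation g := stabilizer.

Lemma stabilizer_psi x : g x *m psi = psi.
Proof. by rewrite -scalemxAl eps_psi scalerA signF2_sqr scale1r. Qed.

Lemma stabilizer_basis x d :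
  g x *m b d = signF2 C ((x *m d^T) 0 0) *: b d.
Proof.
rewrite -scalemxAl (pauli_eigen_shift (u d) (eps_psi x)) scalerA mulrC.
rewrite signF2D -mulrA signF2_sqr mulr1; congr (signF2 _ _ *: _).
by rewrite symplectic_mulmx mxE; apply: eq_bigr => i _; rewrite u_row !mxE.
Qed.

Local Notation eq_mx := (eq_mx_basis syndrome_basis_neq0 syndrome_basis_orth
  card_syndromes).

Lemma stabilizer0 : g 0 = 1%:M.
Proof.
by apply: eq_mx => d; rewrite stabilizer_basis mul0mx mxE scale1r mul1mx.
Qed.

(** Both sides are diagonal in the syndrome basis, and the signs there are characters in [x]; this
    avoids tracking the phases of Pauli products. *)
Lemma stabilizerD x y : g (x + y) = g x *m g y.
Proof.
apply: eq_mx => d; rewrite -mulmxA !stabilizer_basis -scalemxAr stabilizer_basis.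
by rewrite mulmxDl mxE signF2D scalerA mulrC.
Qed.

Lemma stabilizer_inj : injective g.
Proof.
move=> x y gxy; apply/rowP => i.
(* On the basis vector with unit syndrome [i], the sign of [g x] reads off the coordinate
   [x 0 i]. *)
have /eqP := congr1 (mulmx^~ (b (delta_mx 0 i))) gxy.
rewrite /= !stabilizer_basis -subr_eq0 -scalerBl scaler_eq0.
rewrite (negPf (syndrome_basis_neq0 _)) orbF subr_eq0 => /eqP/signF2_inj.
by rewrite trmx_delta -!colE !mxE.
Qed.

Lemma stabilizer_inv x : invmx (g x) = g x.
Proof.
have gg : g x *m g x = 1%:M.
  rewrite -stabilizerD -stabilizer0; congr g; apply/rowP => i; rewrite !mxE.
  by apply: val_inj; case: (F2P (x 0 i)) => ->.
by have [gu _] := mulmx1_unit gg; rewrite -[LHS]mulmx1 -gg mulKmx.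
Qed.

Lemma stabilizer_in_pauli_group x : in_pauli_group (g x).
Proof.
(* The sign is a power of ['i], since ['i ^+ 2 = -1]. *)
exists (2 * eps x)%N, (x *m A).
by rewrite exprM sqrCi.
Qed.

Definition stabilizers : {fset 'M[C]_(qdim n)} :=
  [fset g x | x in 'rV['F_2]_n]%fset.

Lemma stabilizersP s : reflect (exists x, s = g x) (s \in stabilizers).
Proof.
by apply: (iffP (imfsetP _ _ _ _)) => [[x _ ->]|[x ->]]; exists x.
Qed.

Lemma stabilizers_state : stabilizer_state stabilizers psi.
Proof.
by split=> // s /stabilizersP[x ->]; apply: stabilizer_psi.
Qed.

Lemma stabilizers_group : stabilizer_group stabilizers.
Proof.
split.
- by move=> s /stabilizersP[x ->]; apply: stabilizer_in_pauli_group.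
- split.
  + by apply/stabilizersP; exists 0; rewrite stabilizer0.
  + move=> s t /stabilizersP[x ->] /stabilizersP[y ->].
    by apply/stabilizersP; exists (x + y); rewrite stabilizerD.
  + move=> s /stabilizersP[x ->].
    by apply/stabilizersP; exists x; rewrite stabilizer_inv.
- move=> s t /stabilizersP[x ->] /stabilizersP[y ->].
  by rewrite -!stabilizerD addrC.
- by rewrite card_imfset /= -?cardE ?card_syndromes ?qdimE //; apply: stabilizer_inj.
(* If -1 were in the group it would fix [psi], forcing [psi = - psi] and hence [psi = 0]. *)
apply/stabilizersP => -[x Nx]; have := stabilizer_psi x.
rewrite -Nx mul_scalar_mx scaleN1r => /eqP; rewrite eq_sym -addr_eq0.
by rewrite -mulr2n -scaler_nat scaler_eq0 pnatr_eq0 (negPf psi_neq0).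
Qed.

(** The eigenvalue of the projector on [b d] is half of one plus the sign of [d 0 i]: 1 at syndrome
    bit 0, and 0 at bit 1. *)
Lemma limg_row_projector i :
  limg (linfun (mulmx (pauli_projector C (row i A))) : 'End(H)) =
  bspan b (fun d => d 0 i == 0).
Proof.
apply: limg_bspan syndrome_basis_neq0 syndrome_basis_orth card_syndromes _ _ _ => d.
rewrite lfunE /= -scalemxAl mulmxDl mul1mx syndrome_basis_eigen.
case: (F2P (d 0 i)) => ->; last by rewrite scaleN1r subrr scaler0 scale0r.
by rewrite scale1r -mulr2n -scaler_nat scalerA mulVf ?pnatr_eq0 // scale1r.
Qed.

End StabilizerBasis.

(** * The stabilizer state and word operators of the code *)

Theorem theorem4 (R : realType) (n : nat)
    (f : {ffun 'I_n -> bool} -> bool) (e : bexpr n)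
    (A : 'M['F_2]_(n, n + n))
    (f_neq0 : exists c : {ffun 'I_n -> bool}, f c = true)
    (ef : expresses e f)
    (A_free : row_free A)
    (A_isotropic : forall i j : 'I_n, symplectic (row i A) (row j A) = 0) :
  CWS_code (AC06_code R[i] e A).
Proof.
have [psi psi1 Epsi] := exists_stabilized_vector R[i] A_free A_isotropic.
have [u u_row] := fin_all_exists (fun d => symplectic_surj d A_free).
have [eps eps_psi] :=
  fin_all_exists (pauli_span_psi A_isotropic psi1 Epsi u_row).
(* The syndromes at which [e] holds; bit 0 means true, as eigenvalue +1 of a row is eigenvalue 1 of
   its projector. *)
pose T := [pred d : 'rV['F_2]_n | beval (fun i => d 0 i == 0) e].
exists (stabilizers R[i] A eps), psi, #|T|, (fun k => pauli R[i] (u (enum_val k))).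
have orth := syndrome_basis_orth Epsi u_row.
have neq0 := syndrome_basis_neq0 u psi1.
split.
- split; first exact (stabilizers_group psi1 Epsi u_row eps_psi).
  exact: stabilizers_state.
(* The negation matches the convention that syndrome bit 0 encodes true. *)
- have [c fc] := f_neq0; apply/card_gt0P; exists (\row_i (~~ c i)%:R).
  rewrite inE (@eq_beval _ _ c) ?ef // => i.
  by rewrite mxE; case: (c i).
- by move=> k; exists 0, (u (enum_val k)); rewrite scale1r.
- by move=> j k jk; apply: orth; rewrite (inj_eq enum_val_inj).
rewrite /AC06_code (limg_proj_eval neq0 orth (card_syndromes n)
  (c := fun d i => d 0 i == 0)); last exact: (limg_row_projector psi1 Epsi u_row).
apply: eq_span => v; apply/imageP/imageP => [[d Td ->]|[k _ ->]].
  by exists (enum_rank_in Td d); rewrite // enum_rankK_in.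
by exists (enum_val k) => //; apply: enum_valP.
Qed.
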